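(* $\mu\text{-}\mathsf{rec}\preceq\mathsf{WCBV}$.
   Context: A many-one reduction $P\preceq Q$ is a function $f$, definable in constructive type theory without axioms (hence computable), with $P\,x\leftrightarrow Q(f\,x)$ for all instances $x$. $\mu$-recursive algorithms of arity $k$ are built as follows. - $\mathrm{cst}_n$ has arity $0$. - $\mathrm{zero}$ and $\mathrm{succ}$ have arity $1$. - $\mathrm{prj}_p$ has arity $k$, for $p<k$. - $\mathrm{comp}\,f\,\vec g$ has arity $i$, for $f$ of arity $k$ and $\vec g$ a vector of $k$ algorithms of arity $i$. - $\mathrm{rec}\,f\,g$ has arity $1+k$, for $f$ of arity $k$ and $g$ of arity $2+k$. - $\mu f$ has arity $k$, for $f$ of arity $1+k$. Their relational semantics $[\![f]\!]\,\vec v\,x$ is defined as follows. - $[\![\mathrm{cst}_n]\!]\vec v\,x\iff x=n$. - $[\![\mathrm{zero}]\!]\vec v\,x\iff x=0$. - $[\![\mathrm{succ}]\!]\vec v\,x\iff x=v_0+1$. - $[\![\mathrm{prj}_p]\!]\vec v\,x\iff x=v_p$. - $[\![\mathrm{comp}\,f\,\vec g]\!]\vec v\,x\iff\exists\vec w,\ [\![f]\!]\vec w\,x\wedge\forall p,\ [\![g_p]\!]\vec v\,w_p$. - $[\![\mathrm{rec}\,f\,g]\!](0::\vec v)\,x\iff[\![f]\!]\vec v\,x$. - $[\![\mathrm{rec}\,f\,g]\!]((m+1)::\vec v)\,x\iff\exists y,\ [\![\mathrm{rec}\,f\,g]\!](m::\vec v)\,y\wedge[\![g]\!](m::y::\vec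 v)\,x$. - $[\![\mu f]\!]\vec v\,x\iff[\![f]\!](x::\vec v)\,0\wedge\forall y<x\,\exists z,\ [\![f]\!](y::\vec v)(1+z)$. $\mu\text{-}\mathsf{rec}$: given $k$, an algorithm $f$ of arity $k$ and $\vec v\in\mathbb N^k$, is there $x$ with $[\![f]\!]\vec v\,x$? The weak call-by-value $\lambda$-calculus L has terms $s,t::=n\mid s\,t\mid\lambda s$ ($n\in\mathbb N$, De Bruijn indices). Evaluation $s\triangleright t$ is defined inductively. - $\lambda s\triangleright\lambda s$. - $s\,t\triangleright u$ whenever $s\triangleright\lambda s'$, $t\triangleright t'$ and $s'[t'/0]\triangleright u$, where $s'[t'/0]$ substitutes $t'$ for De Bruijn index $0$. $\mathsf{WCBV}$: given a term $s$, is there $t$ with $s\triangleright t$? *)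

(* Defs.v *)
From Stdlib Require Import Arith Vector Cantor.

(** * Mu-recursive algorithms *)

Inductive recalg : nat -> Set :=
| ra_cst  (n : nat) : recalg 0
| ra_zero : recalg 1
| ra_succ : recalg 1
| ra_prj  (k : nat) (p : Fin.t k) : recalg k
| ra_comp (k i : nat) (f : recalg k) (gs : Vector.t (recalg i) k) : recalg i
| ra_rec  (k : nat) (f : recalg k) (g : recalg (2 + k)) : recalg (1 + k)
| ra_mu   (k : nat) (f : recalg (1 + k)) : recalg k.

(** In the [ra_comp] case, [nth (map ra_sem gs) p] is [ra_sem (nth gs p)],
    written so that the nested recursion is accepted. *)
Fixpoint ra_sem {k : nat} (a : recalg k) {struct a} :
    Vector.t nat k -> nat -> Prop :=
  match a in recalg k return Vector.t nat k -> nat -> Prop with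
  | ra_cst n => fun _ x => x = n
  | ra_zero => fun _ x => x = 0
  | ra_succ => fun v x => x = Vector.hd v + 1
  | ra_prj k p => fun v x => x = Vector.nth v p
  | ra_comp k i f gs => fun v x =>
      exists w : Vector.t nat k,
        ra_sem f w x /\
        forall p : Fin.t k,
          Vector.nth (Vector.map (fun g => ra_sem g) gs) p v (Vector.nth w p)
  | ra_rec k f g => fun v =>
      (fix rec_sem (m : nat) (u : Vector.t nat k) (x : nat) {struct m} : Prop :=
         match m with
         | 0 => ra_sem f u x
         | S m' => exists y : nat,
             rec_sem m' u y /\
             ra_sem g (Vector.cons nat m' (1 + k) (Vector.cons nat y k u)) x
         end) (Vector.hd v) (Vector.tl v)
  | ra_mu k f => fun v x =>
      ra_sem f (Vector.cons nat x k v) 0 /\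
      forall y : nat, y < x ->
        exists z : nat, ra_sem f (Vector.cons nat y k v) (1 + z)
  end.

Record mu_rec_instance : Set := MuRecInstance {
  inst_arity : nat;
  inst_alg   : recalg inst_arity;
  inst_args  : Vector.t nat inst_arity
}.

Definition mu_rec (i : mu_rec_instance) : Prop :=
  exists x : nat, ra_sem (inst_alg i) (inst_args i) x.

(** * The weak call-by-value lambda-calculus L *)

Inductive term : Set :=
| var (n : nat)
| app (s t : term)
| lam (s : term).

(** Forster and Smolka's simple substitution for L: [u] is not shifted under
    binders and the other indices are left unchanged.  It coincides with
    capture-avoiding substitution in the reduction of closed terms. *)
Fixpoint subst (s : term) (k : nat) (u : term) : term :=
  match s with
  | var n => if Nat.eqb n k then u else var n
  | app s t => app (subst s k u) (subst t k u)
  | lam s => lam (subst s (S k) u)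
  end.

Inductive eval : term -> term -> Prop :=
| eval_lam (s : term) : eval (lam s) (lam s)
| eval_app (s t s' t' u : term) :
    eval s (lam s') -> eval t t' -> eval (subst s' 0 t') u ->
    eval (app s t) u.

Definition WCBV (s : term) : Prop := exists t : term, eval s t.

(** * Goedel numberings *)

Definition pair_code (x y : nat) : nat := Cantor.to_nat (x, y).

(** The length is recoverable from the code: [nil] is [0] and [cons] is
    positive. *)
Fixpoint vec_code {k : nat} (v : Vector.t nat k) : nat :=
  match v with
  | Vector.nil _ => 0
  | Vector.cons _ x _ v => S (pair_code x (vec_code v))
  end.

Fixpoint recalg_code {k : nat} (a : recalg k) : nat :=
  match a with
  | ra_cst n => pair_code 0 n
  | ra_zero => pair_code 1 0
  | ra_succ => pair_code 2 0
  | ra_prj k p => pair_code 3 (proj1_sig (Fin.to_nat p))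
  | ra_comp k i f gs =>
      pair_code 4 (pair_code (recalg_code f)
                     (vec_code (Vector.map (fun g => recalg_code g) gs)))
  | ra_rec k f g => pair_code 5 (pair_code (recalg_code f) (recalg_code g))
  | ra_mu k f => pair_code 6 (recalg_code f)
  end.

Definition mu_rec_instance_code (i : mu_rec_instance) : nat :=
  pair_code (inst_arity i)
    (pair_code (recalg_code (inst_alg i)) (vec_code (inst_args i))).

Fixpoint term_code (s : term) : nat :=
  match s with
  | var n => pair_code 0 n
  | app s t => pair_code 1 (pair_code (term_code s) (term_code t))
  | lam s => pair_code 2 (term_code s)
  end.

(** * Many-one reductions *)

Definition computable {X Y : Type} (cX : X -> nat) (cY : Y -> nat)
    (f : X -> Y) : Prop :=
  exists c : recalg 1, forall x : X,
    ra_sem c (Vector.cons nat (cX x) 0 (Vector.nil nat)) (cY (f x)).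

(** Definability without axioms cannot be expressed inside the theory, and
    under classical axioms with choice the bare equivalence
    [P x <-> Q (f x)] would be satisfiable by a non-computable [f] deciding
    [P].  Hence the computability of [f] is required explicitly. *)
Definition many_one_reducible {X Y : Type} (cX : X -> nat) (cY : Y -> nat)
    (P : X -> Prop) (Q : Y -> Prop) : Prop :=
  exists f : X -> Y,
    computable cX cY f /\ forall x : X, P x <-> Q (f x).

(* Main.v *)
Require Import Defs.
From Stdlib Require Import Arith Lia Vector Cantor.

(** A fixed closed term [UNIV] of L interprets Goedel numbers of mu-recursive
    instances, so that the reduction maps an instance with code [n] to
    [app UNIV (num n)], where [num n] is the Scott numeral of [n].  Computing the
    code of this term from [n] is a single primitive recursion, so all the work
    is in the interpreter: it decodes numbers by iterating the successor step of
    the inverse Cantor pairing, turns argument vectors into Scott lists, and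
    uses a call-by-value fixed-point combinator for its recursion.  That it
    diverges exactly when the algorithm does is proved by structural induction on
    the algorithm, with an induction on the number of beta steps for [ra_mu]. *)

(** * Evaluation *)

Inductive evaln : nat -> term -> term -> Prop :=
| evaln_lam s : evaln 0 (lam s) (lam s)
| evaln_app a b c s t s' t' u :
    evaln a s (lam s') -> evaln b t t' -> evaln c (subst s' 0 t') u ->
    evaln (S (a + b + c)) (app s t) u.

Lemma evaln_eval n s t : evaln n s t -> eval s t.
Proof. induction 1; econstructor; eassumption. Qed.

Lemma eval_evaln s t : eval s t -> exists n, evaln n s t.
Proof.
  induction 1 as [|s t s' t' u _ [a Ha] _ [b Hb] _ [c Hc]];
    eexists; econstructor; eassumption.
Qed.

Definition value (s : term) : Prop := exists b, s = lam b.

(** Invariance under every substitution, rather than a bound on the free indices, so that closedness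
    acts directly as a rewrite rule. *)
Definition closed (s : term) : Prop := forall k u, subst s k u = s.

Lemma eval_app_inv s t u :
  eval (app s t) u -> (exists s', eval s s') /\ (exists t', eval t t').
Proof. inversion 1; subst; eauto. Qed.

(** Preservation of evaluation in both directions, where the number of beta
    steps does not increase from [s] to [t].  The strict version [sred] drives
    the induction that shows that a terminating unbounded search finds a zero. *)
Definition red (s t : term) : Prop :=
  (forall u, eval t u -> eval s u) /\
  (forall n u, evaln n s u -> exists m, m <= n /\ evaln m t u).

Definition sred (s t : term) : Prop :=
  (forall u, eval t u -> eval s u) /\
  (forall n u, evaln n s u -> exists m, m < n /\ evaln m t u).

Lemma red_refl s : red s s.
Proof. split; eauto. Qed.

Lemma sred_red s t : sred s t -> red s t.
Proof.
  intros [H1 H2]; split; [assumption|].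
  intros n u H; destruct (H2 n u H) as (m & ? & ?); exists m; split; [lia|assumption].
Qed.

Lemma red_trans s t u : red s t -> red t u -> red s u.
Proof.
  intros [A B] [C D]; split; [now eauto|].
  intros n w H; destruct (B _ _ H) as (m & ? & H'); destruct (D _ _ H') as (l & ? & ?).
  exists l; split; [lia|assumption].
Qed.

Lemma sred_red_trans s t u : sred s t -> red t u -> sred s u.
Proof.
  intros [A B] [C D]; split; [now eauto|].
  intros n w H; destruct (B _ _ H) as (m & ? & H'); destruct (D _ _ H') as (l & ? & ?).
  exists l; split; [lia|assumption].
Qed.

Lemma red_app s s' t t' : red s s' -> red t t' -> red (app s t) (app s' t').
Proof.
  intros [A B] [C D]; split.
  - intros u H; inversion H; subst; econstructor; eauto.
  - intros n u H; inversion H; subst.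
    edestruct B as (x & ? & ?); [eassumption|].
    edestruct D as (y & ? & ?); [eassumption|].
    eexists; split; [|econstructor; eassumption]; lia.
Qed.

Lemma sred_app s s' t : sred s s' -> sred (app s t) (app s' t).
Proof.
  intros [A B]; split.
  - intros u H; inversion H; subst; econstructor; eauto.
  - intros n u H; inversion H; subst.
    edestruct B as (x & ? & ?); [eassumption|].
    eexists; split; [|econstructor; eassumption]; lia.
Qed.

(** Values evaluate to themselves in zero steps, so the count drops by exactly the contracted
    step. *)
Lemma sred_beta b t : value t -> sred (app (lam b) t) (subst b 0 t).
Proof.
  intros [c ->]; split.
  - intros u H; econstructor; [constructor|constructor|assumption].
  - intros n u H; inversion H as [|? ? ? ? ? ? ? ? H1 H2]; subst.
    inversion H1; inversion H2; subst.
    eexists; split; [|eassumption]; lia.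
Qed.

Lemma red_beta b t : value t -> red (app (lam b) t) (subst b 0 t).
Proof. intros H; now apply sred_red, sred_beta. Qed.

Lemma red_eval s t u : red s t -> eval s u -> eval t u.
Proof.
  intros [_ H] Hu; destruct (eval_evaln _ _ Hu) as [n Hn].
  destruct (H _ _ Hn) as (m & _ & Hm); eapply evaln_eval; eassumption.
Qed.

(** * Scott encodings and recursion in L *)

Fixpoint num (n : nat) : term :=
  match n with
  | 0 => lam (lam (var 1))
  | S n => lam (lam (app (var 0) (num n)))
  end.

Definition pairv (a b : term) : term := lam (app (app (var 0) a) b).

Definition consv (a l : term) : term := lam (lam (app (app (var 0) a) l)).

Fixpoint vlist {k} (v : Vector.t nat k) : term :=
  match v with
  | Vector.nil _ => num 0
  | Vector.cons _ x _ v => consv (num x) (vlist v)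
  end.

Lemma value_lam b : value (lam b).
Proof. eexists; reflexivity. Qed.

Lemma value_num n : value (num n).
Proof. destruct n; apply value_lam. Qed.

Lemma value_vlist k (v : Vector.t nat k) : value (vlist v).
Proof. destruct v; apply value_lam. Qed.

Lemma closed_num n : closed (num n).
Proof. induction n as [|n IH]; intros k u; cbn; [reflexivity|now rewrite IH]. Qed.

Lemma closed_pairv a b : closed a -> closed b -> closed (pairv a b).
Proof. intros A B k u; unfold pairv; cbn; now rewrite A, B. Qed.

Lemma closed_consv a b : closed a -> closed b -> closed (consv a b).
Proof. intros A B k u; unfold consv; cbn; now rewrite A, B. Qed.

Lemma closed_vlist k (v : Vector.t nat k) : closed (vlist v).
Proof.
  induction v as [|x k v IH]; cbn; [apply (closed_num 0)|].
  apply closed_consv; [apply closed_num|assumption].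
Qed.

(** Turing's fixed-point combinator, eta-expanded for call-by-value:
    [fixA fixA u] reduces to [u (fun x => fixA fixA u x)]. *)
Definition fixA : term :=
  lam (lam (app (var 0) (lam (app (app (app (var 2) (var 2)) (var 1)) (var 0))))).

(** The outer abstraction makes the recursive function a value, so that it can be handed to [u]
    without being unfolded forever. *)
Definition rho (u : term) : term := lam (app (app (app fixA fixA) u) (var 0)).

Lemma closed_rho u : closed u -> closed (rho u).
Proof. intros H k v; unfold rho; cbn; now rewrite H. Qed.

(** Strictness comes from the first beta step, which passes [t] through the eta-expansion; two more
    steps unfold [fixA]. *)
Lemma rho_sred u t : closed u -> value u -> value t ->
  sred (app (rho u) t) (app (app u (rho u)) t).
Proof.
  intros Cu Vu Vt.
  eapply sred_red_trans; [apply sred_beta; assumption|].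
  cbn [subst Nat.eqb]; rewrite Cu.
  change (subst fixA 0 t) with fixA.
  apply red_app; [|apply red_refl].
  eapply red_trans; [apply red_app; [apply red_beta; apply value_lam|apply red_refl]|].
  cbn [subst Nat.eqb].
  eapply red_trans; [apply red_beta; assumption|].
  cbn [subst Nat.eqb].
  change (subst fixA _ u) with fixA.
  apply red_refl.
Qed.

(** The rules for numerals and lists consume one branch only, the other being an ordinary beta step.
    They let normalization keep [num] and [consv] folded. *)
Lemma red_num0 a : closed a -> value a -> red (app (num 0) a) (lam a).
Proof.
  intros C V; eapply red_trans; [now apply red_beta|].
  cbn [subst Nat.eqb]; apply red_refl.
Qed.

Lemma red_numS n a : value a -> red (app (num (S n)) a) (lam (app (var 0) (num n))).
Proof.
  intros V; eapply red_trans; [now apply red_beta|].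
  cbn [subst Nat.eqb]; rewrite closed_num; apply red_refl.
Qed.

Lemma red_consv a l n : closed a -> closed l -> value n ->
  red (app (consv a l) n) (lam (app (app (var 0) a) l)).
Proof.
  intros Ca Cl V; eapply red_trans; [now apply red_beta|].
  cbn [subst Nat.eqb]; rewrite Ca, Cl; apply red_refl.
Qed.

Lemma red_pairv a b h : closed a -> closed b -> value h ->
  red (app (pairv a b) h) (app (app h a) b).
Proof.
  intros Ca Cb V; eapply red_trans; [now apply red_beta|].
  cbn [subst Nat.eqb]; rewrite Ca, Cb; apply red_refl.
Qed.

(* Closedness hints and call-by-value normalization *)
Create HintDb cl.
Create HintDb lred.
#[local] Hint Resolve value_lam value_num value_vlist closed_num closed_pairv
  closed_consv closed_vlist closed_rho : cl.
#[local] Hint Extern 1 (value (rho _)) => apply value_lam : cl.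
#[local] Hint Extern 1 (value (pairv _ _)) => apply value_lam : cl.
#[local] Hint Extern 1 (value (consv _ _)) => apply value_lam : cl.

Ltac subst_closed :=
  cbn [subst Nat.eqb];
  repeat match goal with
    | |- context [subst ?s ?k ?u] =>
        let H := fresh in
        assert (H : closed s) by auto with cl; rewrite (H k u); clear H
    end.

Ltac prove_closed :=
  let k := fresh in let u := fresh in
  intros k u; subst_closed; reflexivity.
#[local] Hint Extern 5 (closed (lam _)) => prove_closed : cl.


(** Call-by-value normalization of the left-hand side of [red s ?t].  Hypotheses
    of the form [red _ _] serve as rewrite rules, and applications of terms
    with no known reduction are left in place. *)
Ltac norm :=
  lazymatch goal with
  | |- red (app _ _) _ =>
      eapply red_trans; [eapply red_app; [norm|norm]|]; norm_head
  | |- _ => apply red_refl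
  end
with norm_head :=
  first
    [ eapply red_trans; [eassumption|]; norm
    | lazymatch goal with
      | |- red (app (lam _) _) _ =>
          eapply red_trans; [apply red_beta; solve [auto with cl]|]
      | |- red (app (num 0) _) _ =>
          eapply red_trans; [apply red_num0; solve [auto with cl]|]
      | |- red (app (num (S _)) _) _ =>
          eapply red_trans; [apply red_numS; solve [auto with cl]|]
      | |- red (app (consv _ _) _) _ =>
          eapply red_trans; [apply red_consv; solve [auto with cl]|]
      | |- red (app (pairv _ _) _) _ =>
          eapply red_trans; [apply red_pairv; solve [auto with cl]|]
      | |- _ =>
          eapply red_trans; [solve [auto 4 with cl lred nocore]|]
      end; subst_closed; norm
    | apply red_refl ].

(** * Data constructors and the inverse Cantor pairing *)

Definition SUCC : term := lam (lam (lam (app (var 0) (var 2)))).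
Definition PAIR : term := lam (lam (lam (app (app (var 0) (var 2)) (var 1)))).
Definition CONS : term := lam (lam (lam (lam (app (app (var 0) (var 3)) (var 2))))).
Definition ID : term := lam (var 0).

Lemma closed_SUCC : closed SUCC. Proof. prove_closed. Qed.
Lemma closed_PAIR : closed PAIR. Proof. prove_closed. Qed.
Lemma closed_CONS : closed CONS. Proof. prove_closed. Qed.
Lemma closed_ID : closed ID. Proof. prove_closed. Qed.
Lemma value_ID : value ID. Proof. apply value_lam. Qed.
#[local] Hint Resolve closed_SUCC closed_PAIR closed_CONS closed_ID value_ID : cl.

Lemma SUCC_red n : red (app SUCC (num n)) (num (S n)).
Proof. unfold SUCC. norm. Qed.

Lemma PAIR_red a b : closed a -> closed b -> value a -> value b ->
  red (app (app PAIR a) b) (pairv a b).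
Proof. intros; unfold PAIR. norm. Qed.

Lemma CONS_red a b : closed a -> closed b -> value a -> value b ->
  red (app (app CONS a) b) (consv a b).
Proof. intros; unfold CONS. norm. Qed.

Lemma ID_red a : value a -> red (app ID a) a.
Proof. intros; unfold ID. norm. Qed.
#[local] Hint Resolve SUCC_red PAIR_red CONS_red ID_red : lred.

(** One step of [Cantor.of_nat]. *)
Definition STEP : term :=
  lam (app (var 0) (lam (lam (app (app (var 1)
    (app (app PAIR (app SUCC (var 0))) (num 0)))
    (lam (app (app PAIR (var 0)) (app SUCC (var 1)))))))).

Definition UNPAIR_body : term :=
  lam (lam (app (app (var 0) (pairv (num 0) (num 0)))
    (lam (app STEP (app (var 2) (var 0)))))).

Definition UNPAIR : term := rho UNPAIR_body.

Lemma closed_STEP : closed STEP. Proof. prove_closed. Qed.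
#[local] Hint Resolve closed_STEP : cl.
Lemma closed_UNPAIR_body : closed UNPAIR_body. Proof. prove_closed. Qed.
#[local] Hint Resolve closed_UNPAIR_body : cl.
Lemma closed_UNPAIR : closed UNPAIR. Proof. apply closed_rho; auto with cl. Qed.
Lemma value_UNPAIR : value UNPAIR. Proof. apply value_lam. Qed.
#[local] Hint Resolve closed_UNPAIR value_UNPAIR : cl.

Lemma STEP_red x y : red (app STEP (pairv (num x) (num y)))
  (match x with
   | S x => pairv (num x) (num (S y))
   | 0 => pairv (num (S y)) (num 0)
   end).
Proof. unfold STEP. destruct x; norm. Qed.

Lemma UNPAIR_of_nat n : red (app UNPAIR (num n))
  (pairv (num (fst (Cantor.of_nat n))) (num (snd (Cantor.of_nat n)))).
Proof.
  induction n as [|n IH];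
    (eapply red_trans;
      [apply sred_red, rho_sred; [auto with cl|apply value_lam|auto with cl]|]);
    fold UNPAIR; unfold UNPAIR_body.
  - norm.
  (* [Cantor.of_nat] is by definition an iteration of this walk along the antidiagonals, the one
     performed by [STEP]. *)
  - change (Cantor.of_nat (S n)) with
      (let '(x, y) := Cantor.of_nat n in
       match x with S x => (x, S y) | 0 => (S y, 0) end).
    destruct (Cantor.of_nat n) as [x y]; cbn [fst snd] in *.
    pose proof (STEP_red x y) as Hs.
    destruct x; norm.
Qed.

Lemma UNPAIR_red x y :
  red (app UNPAIR (num (pair_code x y))) (pairv (num x) (num y)).
Proof.
  pose proof (UNPAIR_of_nat (pair_code x y)) as H; unfold pair_code in *.
  now rewrite Cantor.cancel_of_to in H.
Qed.
#[local] Hint Resolve UNPAIR_red : lred.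

(** * The interpreter *)

(** The second half asks only for some result: by the first half, [s] then behaves as the numeral of
    that result, so its value is this numeral. *)
Definition interprets (s : term) (P : nat -> Prop) : Prop :=
  (forall x, P x -> red s (num x)) /\ (forall t, eval s t -> exists x, P x).

Lemma interprets_red s t P : red s t -> interprets t P -> interprets s P.
Proof.
  intros R [A B]; split; [intros x Hx; eapply red_trans; [eassumption|now apply A]|].
  intros u Hu; eapply B, red_eval; eassumption.
Qed.

Lemma interprets_num x s : red s (num x) -> interprets s (fun y => y = x).
Proof. intros R; split; [now intros ? ->|now exists x]. Qed.

Lemma red_num_eval s x : red s (num x) -> eval s (num x).
Proof. intros [R _]; apply R; destruct x; constructor. Qed.

(** * Combinators for vectors, primitive recursion and minimization *)

Definition MAP_body : term :=
  lam (lam (lam (app (app (var 0) (num 0))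
    (lam (app (app UNPAIR (var 0)) (lam (lam
      (app (app CONS (app (var 4) (var 1)))
        (app (app (var 5) (var 4)) (var 0)))))))))).
Definition MAP : term := rho MAP_body.

(** The list is analysed before the index. The [num 0] of the nil branch is a default value for
    indices out of range. *)
Definition NTH_body : term :=
  lam (lam (lam (app (app (var 0) (num 0))
    (lam (lam (app (app (var 3) (var 1))
      (lam (app (app (var 5) (var 0)) (var 1))))))))).
Definition NTH : term := rho NTH_body.

(** The branches of the case distinctions that recurse or may diverge are
    guarded by a dummy abstraction, which is released by the argument [ID]. *)
Definition REC_body : term :=
  lam (lam (lam (lam (lam (app (app (app (var 0)
    (lam (app (var 4) (var 2))))
    (lam (lam (app (var 4) (app (app CONS (var 1))
       (app (app CONS
          (app (app (app (app (var 6) (var 5)) (var 4)) (var 3)) (var 1)))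
          (var 3)))))))
    ID))))).
Definition REC : term := rho REC_body.

Definition MU_body : term :=
  lam (lam (lam (lam (app (app (app
    (app (var 2) (app (app CONS (var 0)) (var 1)))
    (lam (var 1)))
    (lam (lam (app (app (app (var 5) (var 4)) (var 3)) (app SUCC (var 2))))))
    ID)))).
Definition MU : term := rho MU_body.

Lemma closed_MAP_body : closed MAP_body. Proof. prove_closed. Qed.
Lemma closed_NTH_body : closed NTH_body. Proof. prove_closed. Qed.
Lemma closed_REC_body : closed REC_body. Proof. prove_closed. Qed.
Lemma closed_MU_body : closed MU_body. Proof. prove_closed. Qed.
#[local] Hint Resolve closed_MAP_body closed_NTH_body closed_REC_body
  closed_MU_body : cl.
Lemma closed_MAP : closed MAP. Proof. apply closed_rho; auto with cl. Qed.
Lemma closed_NTH : closed NTH. Proof. apply closed_rho; auto with cl. Qed.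
Lemma closed_REC : closed REC. Proof. apply closed_rho; auto with cl. Qed.
Lemma closed_MU : closed MU. Proof. apply closed_rho; auto with cl. Qed.
Lemma value_MAP : value MAP. Proof. apply value_lam. Qed.
Lemma value_NTH : value NTH. Proof. apply value_lam. Qed.
Lemma value_REC : value REC. Proof. apply value_lam. Qed.
Lemma value_MU : value MU. Proof. apply value_lam. Qed.
#[local] Hint Resolve closed_MAP closed_NTH closed_REC closed_MU
  value_MAP value_NTH value_REC value_MU : cl.

Lemma MAP_unfold h : value h -> red (app MAP h) (app (app MAP_body MAP) h).
Proof. intros; apply sred_red, rho_sred; auto with cl; apply value_lam. Qed.

Lemma NTH_unfold h : value h -> red (app NTH h) (app (app NTH_body NTH) h).
Proof. intros; apply sred_red, rho_sred; auto with cl; apply value_lam. Qed.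

Lemma REC_unfold h : value h -> red (app REC h) (app (app REC_body REC) h).
Proof. intros; apply sred_red, rho_sred; auto with cl; apply value_lam. Qed.

Lemma MU_unfold h : value h -> sred (app MU h) (app (app MU_body MU) h).
Proof. intros; apply rho_sred; auto with cl; apply value_lam. Qed.

Lemma MAP_nil h : value h -> closed h -> red (app (app MAP h) (num 0)) (num 0).
Proof.
  intros; eapply red_trans; [apply red_app; [now apply MAP_unfold|apply red_refl]|].
  unfold MAP_body; norm.
Qed.

(** The right-hand side stops before [CONS] is contracted, since its two arguments may diverge. *)
Lemma MAP_cons h x r : value h -> closed h ->
  red (app (app MAP h) (num (S (pair_code x r))))
    (app (app CONS (app h (num x))) (app (app MAP h) (num r))).
Proof.
  intros; eapply red_trans; [apply red_app; [now apply MAP_unfold|apply red_refl]|].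
  unfold MAP_body; norm.
Qed.

(** [MAP] reads the number [vec_code cs] and returns a Scott list, so it serves both to decode
    argument vectors and to run the inner algorithms of a composition. Call by value makes it
    terminate only if all entries do, as the semantics of composition demands. *)
Lemma MAP_interprets h k (cs : Vector.t nat k) (P : Fin.t k -> nat -> Prop) :
  value h -> closed h ->
  (forall p, interprets (app h (num (Vector.nth cs p))) (P p)) ->
  (forall w : Vector.t nat k, (forall p, P p (Vector.nth w p)) ->
     red (app (app MAP h) (num (vec_code cs))) (vlist w)) /\
  (forall t, eval (app (app MAP h) (num (vec_code cs))) t ->
     exists w : Vector.t nat k, forall p, P p (Vector.nth w p)).
Proof.
  intros V C; induction cs as [|c k cs IH]; intros H.
  - split.
    + intros w _; rewrite (Vector.nil_spec w); now apply MAP_nil.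
    + intros _ _; exists (Vector.nil nat); intros p; inversion p.
  - destruct (IH (fun p => P (Fin.FS p)) (fun p => H (Fin.FS p))) as [A B].
    pose proof (H Fin.F1) as [A0 B0].
    cbn [vec_code Vector.nth Vector.caseS] in *.
    pose proof (MAP_cons h c (vec_code cs) V C) as R.
    split.
    + intros w Hw; rewrite (Vector.eta w) in *.
      pose proof (A0 _ (Hw Fin.F1)) as R0.
      pose proof (A _ (fun p => Hw (Fin.FS p))) as R1.
      cbn in R0, R1 |- *.
      eapply red_trans; [exact R|]; norm.
    + intros t Ht; apply (red_eval _ _ _ R) in Ht.
      (* The evaluation of the [CONS] application forces both the head and the tail. *)
      apply eval_app_inv in Ht as [[? Hl] [? Hr]].
      apply eval_app_inv in Hl as [_ [? Hl]].
      destruct (B0 _ Hl) as [y Hy]; destruct (B _ Hr) as [w Hw].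
      exists (Vector.cons nat y k w); intros p.
      apply (Fin.caseS' p); assumption.
Qed.

Lemma NTH_red k (v : Vector.t nat k) (p : Fin.t k) :
  red (app (app NTH (num (proj1_sig (Fin.to_nat p)))) (vlist v))
    (num (Vector.nth v p)).
Proof.
  induction p as [k|k p IH]; rewrite (Vector.eta v);
    (eapply red_trans;
      [apply red_app; [apply NTH_unfold; auto with cl|apply red_refl]|]).
  - cbn [vlist Fin.to_nat proj1_sig Vector.nth Vector.caseS]; unfold NTH_body; norm.
  - specialize (IH (Vector.tl v)).
    cbn [vlist Fin.to_nat Vector.nth Vector.caseS] in *.
    destruct (Fin.to_nat p) as [m Hm]; cbn [proj1_sig] in *.
    unfold NTH_body; norm.
Qed.

Lemma REC_0 F G k (v : Vector.t nat k) : value F -> closed F -> value G -> closed G ->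
  red (app (app (app (app REC F) G) (vlist v)) (num 0)) (app F (vlist v)).
Proof.
  intros; eapply red_trans;
    [do 3 (eapply red_app; [|apply red_refl]); now apply REC_unfold|].
  unfold REC_body; norm.
Qed.

Lemma REC_S F G k (v : Vector.t nat k) m :
  value F -> closed F -> value G -> closed G ->
  red (app (app (app (app REC F) G) (vlist v)) (num (S m)))
    (app G (app (app CONS (num m)) (app (app CONS
      (app (app (app (app REC F) G) (vlist v)) (num m))) (vlist v)))).
Proof.
  intros; eapply red_trans;
    [do 3 (eapply red_app; [|apply red_refl]); now apply REC_unfold|].
  unfold REC_body; norm.
Qed.

(** The value at [m] is part of the argument of [G], so termination at [S m] forces termination at
    [m], and the induction hypothesis yields the intermediate value. *)
Lemma REC_interprets F G k (v : Vector.t nat k) 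
    (R : nat -> nat -> Prop) (Q : nat -> nat -> nat -> Prop) :
  value F -> closed F -> value G -> closed G ->
  interprets (app F (vlist v)) (R 0) ->
  (forall m y, interprets
     (app G (vlist (Vector.cons nat m _ (Vector.cons nat y _ v)))) (Q m y)) ->
  (forall m x, R (S m) x <-> exists y, R m y /\ Q m y x) ->
  forall m, interprets (app (app (app (app REC F) G) (vlist v)) (num m)) (R m).
Proof.
  intros VF CF VG CG HF HG HR m.
  induction m as [|m [A B]].
  - eapply interprets_red; [now apply REC_0|assumption].
  - eapply interprets_red; [now apply REC_S|].
    assert (K : forall y, R m y -> red
      (app G (app (app CONS (num m)) (app (app CONS
        (app (app (app (app REC F) G) (vlist v)) (num m))) (vlist v))))
      (app G (vlist (Vector.cons nat m _ (Vector.cons nat y _ v))))).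
    { intros y Hy; pose proof (A y Hy) as Ry; cbn [vlist]; norm. }
    split.
    + intros x Hx; apply HR in Hx as (y & Hy & Hx).
      exact (red_trans _ _ _ (K y Hy) (proj1 (HG m y) x Hx)).
    + intros t Ht; pose proof Ht as Ht'.
      (* These inversions descend through [G] and the two [CONS] to the recursive call. *)
      apply eval_app_inv in Ht' as [_ [? E]].
      apply eval_app_inv in E as [_ [? E]].
      apply eval_app_inv in E as [[? E] _].
      apply eval_app_inv in E as [_ [? E]].
      destruct (B _ E) as [y Hy].
      apply (red_eval _ _ _ (K y Hy)) in Ht.
      destruct (proj2 (HG m y) _ Ht) as [z Hz].
      exists z; apply HR; eauto.
Qed.

Lemma MU_unfold3 F k (v : Vector.t nat k) y : value F ->
  sred (app (app (app MU F) (vlist v)) (num y))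
       (app (app (app (app MU_body MU) F) (vlist v)) (num y)).
Proof. intros; now apply sred_app, sred_app, MU_unfold. Qed.

Lemma MU_found F k (v : Vector.t nat k) y : value F -> closed F ->
  red (app F (vlist (Vector.cons nat y _ v))) (num 0) ->
  red (app (app (app MU F) (vlist v)) (num y)) (num y).
Proof.
  intros VF CF H; eapply red_trans; [now apply sred_red, MU_unfold3|].
  cbn [vlist] in H; unfold MU_body; norm.
Qed.

(** The unfolding of [MU] makes the step strict: moving on to the next candidate shortens the
    evaluation. *)
Lemma MU_next F k (v : Vector.t nat k) y z : value F -> closed F ->
  red (app F (vlist (Vector.cons nat y _ v))) (num (S z)) ->
  sred (app (app (app MU F) (vlist v)) (num y))
       (app (app (app MU F) (vlist v)) (num (S y))).
Proof.
  intros VF CF H; eapply sred_red_trans; [now apply MU_unfold3|].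
  cbn [vlist] in H; unfold MU_body; norm.
Qed.

(** After unfolding, the test of [y] stands in head position, below the two branches and [ID], so it
    has to evaluate. *)
Lemma MU_eval F k (v : Vector.t nat k) y t : value F -> closed F ->
  eval (app (app (app MU F) (vlist v)) (num y)) t ->
  exists u, eval (app F (vlist (Vector.cons nat y _ v))) u.
Proof.
  intros VF CF H; eapply red_eval in H; [|now apply sred_red, MU_unfold3].
  eapply red_eval in H; [|unfold MU_body; norm].
  apply eval_app_inv in H as [[? H] _].
  apply eval_app_inv in H as [[? H] _].
  apply eval_app_inv in H as [[? H] _].
  eauto.
Qed.

(** A known zero is reached by induction on the distance [d] from the candidate to it. Conversely,
    each failed test leaves a shorter evaluation by [MU_next], so strong induction on the number of
    steps ends at a zero. *)
Lemma MU_interprets F k (v : Vector.t nat k) (P : nat -> nat -> Prop) :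
  value F -> closed F ->
  (forall y, interprets (app F (vlist (Vector.cons nat y _ v))) (P y)) ->
  interprets (app (app (app MU F) (vlist v)) (num 0))
    (fun x => P x 0 /\ forall y, y < x -> exists z, P y (1 + z)).
Proof.
  intros VF CF H; split.
  - intros x [H0 Hlt].
    assert (K : forall d y, y + d = x ->
              red (app (app (app MU F) (vlist v)) (num y)) (num x)).
    { induction d as [|d IH]; intros y E.
      - rewrite Nat.add_0_r in E; subst y; apply MU_found; [assumption..|].
        now apply (H x).
      - destruct (Hlt y) as [z Hz]; [lia|].
        eapply red_trans; [eapply sred_red, MU_next; [assumption..|]|apply IH; lia].
        apply (H y); exact Hz. }
    now apply (K x).
  - intros t Ht; destruct (eval_evaln _ _ Ht) as [n Hn]; clear Ht.
    (* The invariant records that every candidate before [y] had a positive value. *)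
    assert (K : forall n y, (forall y', y' < y -> exists z, P y' (1 + z)) ->
              evaln n (app (app (app MU F) (vlist v)) (num y)) t ->
              exists x, P x 0 /\ forall y', y' < x -> exists z, P y' (1 + z)).
    { clear n Hn; intros n; induction n as [n IH] using lt_wf_ind; intros y Hy Hn.
      destruct (MU_eval F k v y t VF CF (evaln_eval _ _ _ Hn)) as [u Hu].
      destruct (proj2 (H y) _ Hu) as [[|z] Hz]; [eauto|].
      pose proof (MU_next F k v y z VF CF (proj1 (H y) _ Hz)) as [_ D].
      destruct (D _ _ Hn) as (m & Hm & Hm').
      apply (IH m Hm (S y)); [|assumption].
      intros y' Hy'; destruct (Nat.eq_dec y' y) as [->|]; [eauto|apply Hy; lia]. }
    apply (K n 0); [lia|assumption].
Qed.

(** * Interpreter clauses for the constructors of algorithms *)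

Definition RCST : term := lam (lam (lam (var 1))).
Definition RZERO : term := lam (lam (lam (num 0))).
(** The nil branch is a default, as the arity is positive; likewise in [RREC]. *)
Definition RSUCC : term :=
  lam (lam (lam (app (app (var 0) (num 0)) (lam (lam (app SUCC (var 1))))))).
Definition RPRJ : term := lam (lam (lam (app (app NTH (var 1)) (var 0)))).
Definition RCOMP : term :=
  lam (lam (lam (app (app UNPAIR (var 1)) (lam (lam
    (app (app (var 4) (var 1))
      (app (app MAP (lam (app (app (var 5) (var 0)) (var 3)))) (var 0)))))))).
Definition RREC : term :=
  lam (lam (lam (app (app UNPAIR (var 1)) (lam (lam
    (app (app (var 2) (num 0)) (lam (lam
      (app (app (app (app REC
        (lam (app (app (var 7) (var 4)) (var 0))))
        (lam (app (app (var 7) (var 3)) (var 0))))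
        (var 0)) (var 1)))))))))).
Definition RMU : term :=
  lam (lam (lam (app (app (app MU (lam (app (app (var 3) (var 2)) (var 0))))
    (var 0)) (num 0)))).

Lemma closed_RCST : closed RCST. Proof. prove_closed. Qed.
Lemma closed_RZERO : closed RZERO. Proof. prove_closed. Qed.
Lemma closed_RSUCC : closed RSUCC. Proof. prove_closed. Qed.
Lemma closed_RPRJ : closed RPRJ. Proof. prove_closed. Qed.
Lemma closed_RCOMP : closed RCOMP. Proof. prove_closed. Qed.
Lemma closed_RREC : closed RREC. Proof. prove_closed. Qed.
Lemma closed_RMU : closed RMU. Proof. prove_closed. Qed.
#[local] Hint Resolve closed_RCST closed_RZERO closed_RSUCC closed_RPRJ
  closed_RCOMP closed_RREC closed_RMU : cl.
Lemma value_RCST : value RCST. Proof. apply value_lam. Qed.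
Lemma value_RZERO : value RZERO. Proof. apply value_lam. Qed.
Lemma value_RSUCC : value RSUCC. Proof. apply value_lam. Qed.
Lemma value_RPRJ : value RPRJ. Proof. apply value_lam. Qed.
Lemma value_RCOMP : value RCOMP. Proof. apply value_lam. Qed.
Lemma value_RREC : value RREC. Proof. apply value_lam. Qed.
Lemma value_RMU : value RMU. Proof. apply value_lam. Qed.
#[local] Hint Resolve value_RCST value_RZERO value_RSUCC value_RPRJ
  value_RCOMP value_RREC value_RMU : cl.

(** Nested case distinction on the tag, where every tag from 6 on selects [RMU]. All clauses take
    the interpreter, the payload of the code and the argument list, in this order. *)
Definition DISPATCH : term :=
  lam (app (app (var 0) RCST) (lam
    (app (app (var 0) RZERO) (lam
    (app (app (var 0) RSUCC) (lam
    (app (app (var 0) RPRJ) (lam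
    (app (app (var 0) RCOMP) (lam
    (app (app (var 0) RREC) (lam RMU)))))))))))).

Definition INTERP_body : term :=
  lam (lam (app (app UNPAIR (var 0)) (lam (lam
    (app (app (app DISPATCH (var 1)) (var 3)) (var 0)))))).
Definition INTERP : term := rho INTERP_body.

Lemma closed_DISPATCH : closed DISPATCH. Proof. prove_closed. Qed.
#[local] Hint Resolve closed_DISPATCH : cl.
Lemma closed_INTERP_body : closed INTERP_body. Proof. prove_closed. Qed.
#[local] Hint Resolve closed_INTERP_body : cl.
Lemma closed_INTERP : closed INTERP. Proof. apply closed_rho; auto with cl. Qed.
Lemma value_INTERP : value INTERP. Proof. apply value_lam. Qed.
#[local] Hint Resolve closed_INTERP value_INTERP : cl.

Lemma INTERP_unfold x r v :
  red (app (app INTERP (num (pair_code x r))) v)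
    (app (app (app (app DISPATCH (num x)) INTERP) (num r)) v).
Proof.
  apply red_app; [|apply red_refl].
  eapply red_trans; [apply sred_red, rho_sred; auto with cl; apply value_lam|].
  fold INTERP; unfold INTERP_body; norm.
Qed.

Lemma INTERP_cst n v : value v -> closed v ->
  red (app (app INTERP (num (pair_code 0 n))) v) (num n).
Proof.
  intros; eapply red_trans; [apply INTERP_unfold|]; unfold DISPATCH, RCST; norm.
Qed.

Lemma INTERP_zero n v : value v -> closed v ->
  red (app (app INTERP (num (pair_code 1 n))) v) (num 0).
Proof.
  intros; eapply red_trans; [apply INTERP_unfold|]; unfold DISPATCH, RZERO; norm.
Qed.

Lemma INTERP_succ n x v : value v -> closed v ->
  red (app (app INTERP (num (pair_code 2 n))) (consv (num x) v)) (num (S x)).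
Proof.
  intros; eapply red_trans; [apply INTERP_unfold|]; unfold DISPATCH, RSUCC; norm.
Qed.

Lemma INTERP_prj p v : value v -> closed v ->
  red (app (app INTERP (num (pair_code 3 p))) v) (app (app NTH (num p)) v).
Proof.
  intros; eapply red_trans; [apply INTERP_unfold|]; unfold DISPATCH, RPRJ; norm.
Qed.

Lemma INTERP_comp f gs v : value v -> closed v ->
  red (app (app INTERP (num (pair_code 4 (pair_code f gs)))) v)
    (app (app INTERP (num f))
      (app (app MAP (lam (app (app INTERP (var 0)) v))) (num gs))).
Proof.
  intros; eapply red_trans; [apply INTERP_unfold|]; unfold DISPATCH, RCOMP; norm.
Qed.

(** [INTERP_at c] is an eta-expansion of [app INTERP (num c)], which makes it
    a closed value. *)
Definition INTERP_at (c : nat) : term := lam (app (app INTERP (num c)) (var 0)).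

Lemma INTERP_rec f g m v : value v -> closed v ->
  red (app (app INTERP (num (pair_code 5 (pair_code f g)))) (consv (num m) v))
    (app (app (app (app REC (INTERP_at f)) (INTERP_at g)) v) (num m)).
Proof.
  intros; eapply red_trans; [apply INTERP_unfold|]; unfold DISPATCH, RREC; norm.
Qed.

Lemma INTERP_mu f v : value v -> closed v ->
  red (app (app INTERP (num (pair_code 6 f))) v)
    (app (app (app MU (INTERP_at f)) v) (num 0)).
Proof.
  intros; eapply red_trans; [apply INTERP_unfold|]; unfold DISPATCH, RMU; norm.
Qed.

Lemma INTERP_at_red c v : value v -> closed v ->
  red (app (INTERP_at c) v) (app (app INTERP (num c)) v).
Proof. intros; unfold INTERP_at; norm. Qed.

Lemma closed_INTERP_at c : closed (INTERP_at c).
Proof. unfold INTERP_at; prove_closed. Qed.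

Lemma value_INTERP_at c : value (INTERP_at c).
Proof. apply value_lam. Qed.
#[local] Hint Resolve closed_INTERP_at value_INTERP_at : cl.

(** * Correctness of the interpreter and the universal term *)

Fixpoint recalg_nested_ind (P : forall k, recalg k -> Prop)
    (Hcst : forall n, P 0 (ra_cst n)) (Hzero : P 1 ra_zero)
    (Hsucc : P 1 ra_succ) (Hprj : forall k p, P k (ra_prj k p))
    (Hcomp : forall k i f gs, P k f -> (forall p, P i (Vector.nth gs p)) ->
       P i (ra_comp k i f gs))
    (Hrec : forall k f g, P k f -> P (2 + k) g -> P (1 + k) (ra_rec k f g))
    (Hmu : forall k f, P (1 + k) f -> P k (ra_mu k f))
    k (a : recalg k) {struct a} : P k a.
Proof.
  pose (IH := recalg_nested_ind P Hcst Hzero Hsucc Hprj Hcomp Hrec Hmu).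
  destruct a as [n| | |k p|k i f gs|k f g|k f].
  - apply Hcst.
  - apply Hzero.
  - apply Hsucc.
  - apply Hprj.
  - apply Hcomp; [apply IH|].
    (* The inner induction on the vector supplies the hypotheses for the nested algorithms, which
       the generated principle omits. *)
    clear f; induction gs as [|g k' gs IHgs]; intros p; [inversion p|].
    apply (Fin.caseS' p); [apply IH|exact IHgs].
  - apply Hrec; apply IH.
  - apply Hmu; apply IH.
Qed.

(** The vector is generalized because composition, recursion and minimization run their
    subalgorithms on other vectors. *)
Lemma INTERP_interprets k (a : recalg k) (v : Vector.t nat k) :
  interprets (app (app INTERP (num (recalg_code a))) (vlist v)) (ra_sem a v).
Proof.
  revert v; induction a as
    [n| | |k p|k i f gs IHf IHgs|k f g IHf IHg|k f IHf] using recalg_nested_ind;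
    intros v; cbn [recalg_code].
  - apply interprets_num, INTERP_cst; auto with cl.
  - apply interprets_num, INTERP_zero; auto with cl.
  - rewrite (Vector.eta v); cbn [ra_sem Vector.hd Vector.caseS].
    apply interprets_num; rewrite Nat.add_1_r.
    apply INTERP_succ; auto with cl.
  - apply interprets_num; eapply red_trans; [apply INTERP_prj; auto with cl|].
    apply NTH_red.
  - eapply interprets_red; [apply INTERP_comp; auto with cl|].
    set (h := lam _).
    assert (Ch : closed h) by (unfold h; auto with cl).
    destruct (MAP_interprets h k (Vector.map (fun g => recalg_code g) gs)
                (fun p => ra_sem (Vector.nth gs p) v)) as [A B];
      [apply value_lam|assumption| |].
    { intros p; rewrite (Vector.nth_map _ _ _ _ eq_refl).
      eapply interprets_red; [|apply IHgs].
      unfold h; norm. }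
    (* Removes the [Vector.map] through which [ra_sem] expresses its nested recursion. *)
    assert (E : forall w, (forall p, Vector.nth
                (Vector.map (fun g => ra_sem g) gs) p v (Vector.nth w p)) <->
              (forall p, ra_sem (Vector.nth gs p) v (Vector.nth w p))).
    { intros w; split; intros H p; specialize (H p);
        rewrite (Vector.nth_map _ _ _ _ eq_refl) in *; assumption. }
    cbn [ra_sem]; split.
    + intros x (w & Hx & Hw); pose proof (proj1 (E w) Hw) as Hw'.
      eapply red_trans; [apply red_app; [apply red_refl|exact (A w Hw')]|].
      exact (proj1 (IHf w) x Hx).
    + intros t Ht; pose proof (eval_app_inv _ _ _ Ht) as [_ [u Hu]].
      destruct (B u Hu) as [w Hw].
      (* The argument list is now known to reduce to [vlist w], which puts the evaluation in the
         form required by the hypothesis for [f]. *)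
      assert (R := red_app _ _ _ _ (red_refl (app INTERP (num (recalg_code f)))) (A w Hw)).
      destruct (proj2 (IHf w) t (red_eval _ _ _ R Ht)) as [x Hx].
      exists x, w; split; [assumption|exact (proj2 (E w) Hw)].
  - rewrite (Vector.eta v); cbn [vlist].
    eapply interprets_red; [apply INTERP_rec; auto with cl|].
    apply (REC_interprets _ _ _ _
      (fun m => ra_sem (ra_rec k f g) (Vector.cons nat m k (Vector.tl v)))
      (fun m y => ra_sem g
         (Vector.cons nat m _ (Vector.cons nat y _ (Vector.tl v)))));
      auto with cl.
    + eapply interprets_red; [apply INTERP_at_red; auto with cl|apply IHf].
    + intros m y.
      eapply interprets_red; [apply INTERP_at_red; auto with cl|apply IHg].
    (* The recursion equation of the semantics at [S m] holds by conversion. *)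
    + reflexivity.
  - eapply interprets_red; [apply INTERP_mu; auto with cl|].
    apply (MU_interprets _ _ _ (fun y => ra_sem f (Vector.cons nat y k v)));
      auto with cl.
    intros y; eapply interprets_red; [apply INTERP_at_red; auto with cl|apply IHf].
Qed.

Definition UNIV : term :=
  lam (app (app UNPAIR (var 0)) (lam (lam
    (app (app UNPAIR (var 0)) (lam (lam
      (app (app INTERP (var 1)) (app (app MAP ID) (var 0))))))))).

Lemma UNIV_red i : red (app UNIV (num (mu_rec_instance_code i)))
  (app (app INTERP (num (recalg_code (inst_alg i)))) (vlist (inst_args i))).
Proof.
  destruct i as [k a v]; unfold mu_rec_instance_code; cbn [inst_arity inst_alg inst_args].
  assert (H : red (app (app MAP ID) (num (vec_code v))) (vlist v)).
  (* With [ID], the relation at [p] is equality with the entry of [v], so [MAP] merely decodes the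
     vector. *)
  { apply (MAP_interprets ID k v (fun p x => x = Vector.nth v p)); auto with cl.
    intros p; apply interprets_num, ID_red; auto with cl. }
  unfold UNIV; norm.
Qed.

Lemma UNIV_spec i : mu_rec i <-> WCBV (app UNIV (num (mu_rec_instance_code i))).
Proof.
  pose proof (interprets_red _ _ _ (UNIV_red i)
    (INTERP_interprets _ (inst_alg i) (inst_args i))) as [A B].
  split.
  - intros [x Hx]; exists (num x); apply red_num_eval; exact (A x Hx).
  - intros [t Ht]; exact (B t Ht).
Qed.

(** * Computability of [fun n => term_code (app s (num n))] *)

Definition computes {k} (c : recalg k) (f : Vector.t nat k -> nat) : Prop :=
  forall v, ra_sem c v (f v).

Definition comp1 {i} (f : recalg 1) (g : recalg i) : recalg i :=
  ra_comp 1 i f (Vector.cons _ g _ (Vector.nil _)).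

Definition comp2 {i} (f : recalg 2) (g h : recalg i) : recalg i :=
  ra_comp 2 i f (Vector.cons _ g _ (Vector.cons _ h _ (Vector.nil _))).

Lemma comp1_computes i f g (F : nat -> nat) G :
  computes f (fun v => F (Vector.hd v)) -> computes g G ->
  computes (@comp1 i f g) (fun v => F (G v)).
Proof.
  intros Hf Hg v; exists (Vector.cons _ (G v) _ (Vector.nil _)); split; [apply Hf|].
  intros p; apply (Fin.caseS' p); [apply Hg|intros q; inversion q].
Qed.

Lemma comp2_computes i f g h (F : nat -> nat -> nat) G H :
  computes f (fun v => F (Vector.hd v) (Vector.hd (Vector.tl v))) ->
  computes g G -> computes h H ->
  computes (@comp2 i f g h) (fun v => F (G v) (H v)).
Proof.
  intros Hf Hg Hh v.
  exists (Vector.cons _ (G v) _ (Vector.cons _ (H v) _ (Vector.nil _))); split; [apply Hf|].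
  intros p; apply (Fin.caseS' p); [apply Hg|intros q].
  apply (Fin.caseS' q); [apply Hh|intros r; inversion r].
Qed.

Definition const {k} (n : nat) : recalg k := ra_comp 0 k (ra_cst n) (Vector.nil _).

Lemma const_computes k n : computes (@const k n) (fun _ => n).
Proof.
  intros v; exists (Vector.nil _); split; [reflexivity|intros p; inversion p].
Qed.

Lemma succ_computes : computes ra_succ (fun v => S (Vector.hd v)).
Proof. intros v; cbn; lia. Qed.

Lemma fst_computes k : computes (ra_prj (S k) Fin.F1) (@Vector.hd nat k).
Proof. intros v; rewrite (Vector.eta v); reflexivity. Qed.

Lemma snd_computes k :
  computes (ra_prj (S (S k)) (Fin.FS Fin.F1)) (fun v => Vector.hd (Vector.tl v)).
Proof.
  intros v; rewrite (Vector.eta v), (Vector.eta (Vector.tl v)); reflexivity.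
Qed.

Lemma rec_computes k f g (F : Vector.t nat k -> nat) (G : nat -> nat -> nat) :
  computes f F ->
  computes g (fun v => G (Vector.hd v) (Vector.hd (Vector.tl v))) ->
  computes (ra_rec k f g) (fun v =>
    nat_rec (fun _ => nat) (F (Vector.tl v)) G (Vector.hd v)).
Proof.
  intros Hf Hg v; rewrite (Vector.eta v); cbn [Vector.hd Vector.tl Vector.caseS].
  induction (Vector.hd v) as [|m IH]; [apply Hf|].
  eexists; split; [exact IH|].
  exact (Hg (Vector.cons _ m _ (Vector.cons _ _ _ (Vector.tl v)))).
Qed.

Lemma computes_ext k (c : recalg k) f g :
  computes c f -> (forall v, f v = g v) -> computes c g.
Proof. intros H E v; rewrite <- E; apply H. Qed.

Lemma add_computable :
  exists c, computes c (fun v : Vector.t nat 2 => Vector.hd v + Vector.hd (Vector.tl v)).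
Proof.
  eexists; eapply computes_ext.
  - eapply (rec_computes 1 _ _ (@Vector.hd nat 0) (fun _ y => S y));
      [apply fst_computes|].
    apply comp1_computes; [apply succ_computes|apply snd_computes].
  - intros v; cbn beta; induction (Vector.hd v) as [|m IH]; [reflexivity|].
    cbn; now rewrite IH.
Qed.

(** The Cantor code of [(x, y)] is [y] plus the triangular number of [y + x], and triangular numbers
    arise by primitive recursion. *)
Lemma pair_computable :
  exists c, computes c (fun v : Vector.t nat 2 =>
    pair_code (Vector.hd v) (Vector.hd (Vector.tl v))).
Proof.
  destruct add_computable as [add Hadd].
  assert (Ht : exists tri, computes tri (fun v =>
    nat_rec (fun _ => nat) 0 (fun i m => S i + m) (@Vector.hd nat 0 v))).
  { eexists; eapply (rec_computes 0 _ _ (fun _ => 0) (fun i m => S i + m));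
      [apply const_computes|].
    apply comp2_computes with (F := Nat.add); [exact Hadd| |apply snd_computes].
    apply comp1_computes; [apply succ_computes|apply fst_computes]. }
  destruct Ht as [tri Htri].
  eexists; unfold pair_code, Cantor.to_nat.
  apply comp2_computes with (F := Nat.add); [exact Hadd|apply snd_computes|].
  eapply (comp1_computes 2 tri _ _ _ Htri).
  apply comp2_computes with (F := Nat.add);
    [exact Hadd|apply snd_computes|apply fst_computes].
Qed.

(** The code of the predecessor is wrapped in a fixed sequence of pairings, which is the step of the
    primitive recursion below. *)
Lemma term_code_num_S n : term_code (num (S n)) =
  pair_code 2 (pair_code 2 (pair_code 1 (pair_code (pair_code 0 0) (term_code (num n))))).
Proof. reflexivity. Qed.

Lemma app_num_computable s : computable (fun n => n) term_code (fun n => app s (num n)).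
Proof.
  destruct pair_computable as [pair Hpair].
  assert (Hn : exists c, computes c (fun v => term_code (num (@Vector.hd nat 0 v)))).
  { eexists; eapply computes_ext.
    - eapply (rec_computes 0 _ _ (fun _ => term_code (num 0)) (fun _ y =>
        pair_code 2 (pair_code 2 (pair_code 1 (pair_code (pair_code 0 0) y)))));
        [apply const_computes|].
      repeat (apply comp2_computes with (F := pair_code);
        [exact Hpair|apply const_computes|]).
      apply snd_computes.
    - intros v; cbn beta; induction (Vector.hd v) as [|m IH]; [reflexivity|].
      rewrite term_code_num_S, <- IH; reflexivity. }
  destruct Hn as [cn Hn].
  eexists; intros n.
  (* The constant 1 is the tag of [app] in [term_code]. *)
  apply (comp2_computes 1 pair (const 1) (comp2 pair (const (term_code s)) cn)
    pair_code (fun _ => 1)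
    (fun v => pair_code (term_code s) (term_code (num (Vector.hd v))))
    Hpair (const_computes 1 1)).
  apply comp2_computes with (F := pair_code); [exact Hpair|apply const_computes|exact Hn].
Qed.

Theorem theorem11p4 :
  many_one_reducible mu_rec_instance_code term_code mu_rec WCBV.
Proof.
  exists (fun i => app UNIV (num (mu_rec_instance_code i))); split.
  (* The reduction depends on [i] only through its code, so an algorithm acting on all numbers
     suffices. *)
  - destruct (app_num_computable UNIV) as [c Hc].
    exists c; intros i; apply Hc.
  - apply UNIV_spec.
Qed.
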